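(* Let $\mathcal{B}\subseteq\mathcal{A}$ be a unital inclusion of C*-algebras. The following are equivalent: 1. $\mathcal{B}\subseteq\mathcal{A}$ is C*-irreducible. 2. $(\mathcal{A},G)$ is strongly minimal for every subgroup $G\leq U(\mathcal{B})$ whose linear span is norm dense in $\mathcal{B}$, where $G$ acts on $\mathcal{A}$ by unitary conjugation. 3. $(\mathcal{A},G)$ is strongly minimal for some subgroup $G\leq U(\mathcal{B})$ whose linear span is norm dense in $\mathcal{B}$, where $G$ acts on $\mathcal{A}$ by unitary conjugation.
   Context: $U(\mathcal{B})$ is the unitary group of $\mathcal{B}$; groups are regarded as discrete. C*-algebras are nonzero. A unital inclusion $\mathcal{B}\subseteq\mathcal{A}$ of C*-algebras is one in which $\mathcal{A}$ is unital and $1_{\mathcal{A}}\in\mathcal{B}$. It is C*-irreducible if every C*-algebra $\mathcal{D}$ with $\mathcal{B}\subseteq\mathcal{D}\subseteq\mathcal{A}$ is simple. If a discrete group $G$ acts on a C*-algebra $\mathcal{A}$ by $*$-automorphisms, then $(\mathcal{A},G)$ is strongly minimal if the only $G$-invariant closed left ideals of $\mathcal{A}$ are $\{0\}$ and $\mathcal{A}$. The conjugation action is $u\cdot x=uxu^*$. *)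

(* Defs.v *)
From HB Require Import structures.
From mathcomp Require Import all_boot all_order all_algebra.
From mathcomp Require Import complex.
From mathcomp Require Import boolp classical_sets reals topology normedtype.

Set Implicit Arguments.
Unset Strict Implicit.
Unset Printing Implicit Defensive.

Import Order.TTheory GRing.Theory Num.Theory.
Import numFieldNormedType.Exports.

Local Open Scope classical_set_scope.
Local Open Scope ring_scope.

(* Unital C*-algebras over C = R[i]; norms are nonnegative reals of R[i].
   numDomainType already joins rings and normed modules, so Hierarchy-Builder
   rejects a structure joining them at a weaker level: the product is part of
   the mixin, and the algType structure is attached to the carrier below. *)
HB.mixin Record CompleteNormedModule_isCStarAlg (R : realType) A
    of CompleteNormedModule R[i] A := {
  cstar_one : A;
  cstar_mul : A -> A -> A;
  cstar_mulA : associative cstar_mul;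
  cstar_mul1 : left_id cstar_one cstar_mul;
  cstar_mulr1 : right_id cstar_one cstar_mul;
  cstar_mulDl : left_distributive cstar_mul +%R;
  cstar_mulDr : right_distributive cstar_mul +%R;
  cstar_one_neq0 : cstar_one != 0;
  cstar_scaleAl : forall (a : R[i]) (x y : A),
    a *: cstar_mul x y = cstar_mul (a *: x) y;
  cstar_scaleAr : forall (a : R[i]) (x y : A),
    a *: cstar_mul x y = cstar_mul x (a *: y);
  star : A -> A;
  starK : involutive star;
  starD : {morph star : x y / x + y};
  starZ : forall (a : R[i]) (x : A), star (a *: x) = Num.conj a *: star x;
  star_mul : forall x y : A, star (cstar_mul x y) = cstar_mul (star y) (star x);
  cstar_norm_mul : forall x y : A, `|cstar_mul x y| <= `|x| * `|y|;
  cstar_norm_star : forall x : A, `|cstar_mul (star x) x| = `|x| ^+ 2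
}.

#[short(type="cstarAlgType")]
HB.structure Definition CStarAlg (R : realType) :=
  {A of CompleteNormedModule_isCStarAlg R A & CompleteNormedModule R[i] A}.

Section CStarAlgIsAlgebra.
Variables (R : realType) (A : cstarAlgType R).

HB.instance Definition _ := GRing.Zmodule_isNzRing.Build (CStarAlg.sort A)
  (@cstar_mulA R A) (@cstar_mul1 R A) (@cstar_mulr1 R A)
  (@cstar_mulDl R A) (@cstar_mulDr R A) (@cstar_one_neq0 R A).
HB.instance Definition _ := GRing.Lmodule_isLalgebra.Build R[i]
  (CStarAlg.sort A) (@cstar_scaleAl R A).
HB.instance Definition _ := GRing.Lalgebra_isAlgebra.Build R[i]
  (CStarAlg.sort A) (@cstar_scaleAr R A).

Lemma starM (x y : A) : star (x * y) = star y * star x.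
Proof. exact: star_mul. Qed.

Lemma cstar_normM (x y : A) : `|x * y| <= `|x| * `|y|.
Proof. exact: cstar_norm_mul. Qed.

Lemma cstar_normE (x : A) : `|star x * x| = `|x| ^+ 2.
Proof. exact: cstar_norm_star. Qed.

Lemma star1 : star 1 = 1 :> A.
Proof. by rewrite -[LHS]mulr1 -[X in _ * X](starK 1) -starM mulr1 starK. Qed.

End CStarAlgIsAlgebra.

Section Subalgebras.
Context {R : realType} {A : cstarAlgType R}.

Definition span (S : set A) : set A :=
  [set x | exists n (c : 'I_n -> R[i]) (s : 'I_n -> A),
     (forall i, S (s i)) /\ x = \sum_i c i *: s i].

(* Possibly nonunital C*-subalgebras, as subsets of A; C*-algebras are nonzero
   by convention. *)
Record cstar_subalgebra (D : set A) : Prop := CStarSubalgebra {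
  cstar_sub_submod : submod_closed [in D];
  cstar_subM : forall x y, D x -> D y -> D (x * y);
  cstar_sub_star : forall x, D x -> D (star x);
  cstar_sub_closed : closed D;
  cstar_sub_neq0 : D <> [set 0]
}.

Record closed_ideal (D I : set A) : Prop := ClosedIdeal {
  ideal_sub : I `<=` D;
  ideal_submod : submod_closed [in I];
  ideal_mull : forall d x, D d -> I x -> I (d * x);
  ideal_mulr : forall d x, D d -> I x -> I (x * d);
  ideal_closed : closed I
}.

Definition cstar_simple (D : set A) : Prop :=
  forall I : set A, closed_ideal D I -> I = [set 0] \/ I = D.

Record closed_left_ideal (I : set A) : Prop := ClosedLeftIdeal {
  lideal_submod : submod_closed [in I];
  lideal_mull : forall a x, I x -> I (a * x);
  lideal_closed : closed I
}.

Definition cstar_irreducible (B : set A) : Prop :=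
  forall D : set A, cstar_subalgebra D -> B `<=` D -> cstar_simple D.

End Subalgebras.

Record unitalCStarSub (R : realType) (A : cstarAlgType R) := UnitalCStarSub {
  ucs_set :> set A;
  ucs_subalgebra : cstar_subalgebra ucs_set;
  ucs_one : ucs_set 1
}.

Section Unitary.
Context {R : realType} {A : cstarAlgType R}.

Variable B : unitalCStarSub A.

Definition unitary_in : pred A :=
  [pred u | [&& u \in (B : set A), star u * u == 1 & u * star u == 1]].

Record unitary := Unitary {uval : A; uvalP : unitary_in uval}.

HB.instance Definition _ := [isSub for uval].
HB.instance Definition _ := [Choice of unitary by <:].

Lemma unitaryP (u : unitary) :
  [/\ (B : set A) (uval u), star (uval u) * uval u = 1
    & uval u * star (uval u) = 1].
Proof. by case: u => u /= /and3P[/set_mem ? /eqP ? /eqP ?]. Qed.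

Fact unitary_one_subproof : unitary_in 1.
Proof.
apply/and3P; split; rewrite ?star1 ?mulr1 //.
by apply/mem_set; exact: ucs_one.
Qed.

Fact unitary_inv_subproof (u : unitary) : unitary_in (star (uval u)).
Proof.
have [Bu su us] := unitaryP u.
apply/and3P; split; rewrite ?starK ?su ?us //.
by apply/mem_set; apply: cstar_sub_star Bu; exact: ucs_subalgebra.
Qed.

Fact unitary_mul_subproof (u v : unitary) : unitary_in (uval u * uval v).
Proof.
have [Bu su us] := unitaryP u; have [Bv sv vs] := unitaryP v.
apply/and3P; split.
- by apply/mem_set; apply: cstar_subM => //; exact: ucs_subalgebra.
- by rewrite starM mulrA -(mulrA (star (uval v))) su mulr1 sv.
- by rewrite starM mulrA -(mulrA (uval u)) vs mulr1 us.
Qed.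

Let uone := Unitary unitary_one_subproof.
Let uinv u := Unitary (unitary_inv_subproof u).
Let umul u v := Unitary (unitary_mul_subproof u v).

Fact umulA : associative umul.
Proof. by move=> u v w; apply/val_inj; rewrite /= mulrA. Qed.
Fact umul1 : left_id uone umul.
Proof. by move=> u; apply/val_inj; rewrite /= mul1r. Qed.
Fact umulr1 : right_id uone umul.
Proof. by move=> u; apply/val_inj; rewrite /= mulr1. Qed.
Fact umulV : left_inverse uone uinv umul.
Proof. by move=> u; apply/val_inj; have [] := unitaryP u. Qed.
Fact umulrV : right_inverse uone uinv umul.
Proof. by move=> u; apply/val_inj; have [] := unitaryP u. Qed.

HB.instance Definition _ :=
  isGroup.Build unitary umulA umul1 umulr1 umulV umulrV.

End Unitary.

Arguments unitary {R A} B.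

(* A subgroup, seen as a group in its own right. *)
Record subgroup (H : groupType) (G : groupClosed H) :=
  Subgroup {sgval : H; sgvalP : sgval \in G}.

Section Subgroup.
Variables (H : groupType) (G : groupClosed H).

HB.instance Definition _ := [isSub for @sgval H G].
HB.instance Definition _ := [Choice of subgroup G by <:].

End Subgroup.

Section SubgroupIsGroup.
Variables (H : groupType) (G : groupClosed H).

Fact subgroup_closed : group_closed G.
Proof. by split=> [|u v uG vG]; rewrite ?gpred1 ?gpredF. Qed.

HB.instance Definition _ :=
  SubChoice_isSubGroup.Build H _ (subgroup G) subgroup_closed.

End SubgroupIsGroup.

Record star_automorphism (R : realType) (A : cstarAlgType R) (f : A -> A) :
    Prop := StarAutomorphism {
  star_aut_bij : bijective f;
  star_aut_linear : linear f;
  star_autM : {morph f : x y / x * y};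
  star_aut_star : {morph f : x / star x}
}.

Record cstar_action (H : groupType) (R : realType) (A : cstarAlgType R) :=
    CStarAction {
  act :> H -> A -> A;
  act1 : forall x, act 1%g x = x;
  actM : forall g h x, act (g * h)%g x = act g (act h x);
  act_aut : forall g, star_automorphism (act g)
}.

Definition strongly_minimal (H : groupType) (R : realType)
    (A : cstarAlgType R) (alpha : cstar_action H A) : Prop :=
  forall I : set A, closed_left_ideal I ->
    (forall g : H, alpha g @` I `<=` I) -> I = [set 0] \/ I = setT.

Section Conjugation.
Context {R : realType} {A : cstarAlgType R} {B : unitalCStarSub A}.
Variable G : groupClosed (unitary B).

Definition conj_act (g : subgroup G) (x : A) : A :=
  uval (sgval g) * x * star (uval (sgval g)).

Fact conj_act1 x : conj_act 1%g x = x.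
Proof. by rewrite /conj_act /= star1 mul1r mulr1. Qed.

Fact conj_actM g h x : conj_act (g * h)%g x = conj_act g (conj_act h x).
Proof. by rewrite /conj_act /= starM !mulrA. Qed.

Fact conj_act_aut g : star_automorphism (conj_act g).
Proof.
rewrite /conj_act; have [_ su us] := unitaryP (sgval g).
move: (uval (sgval g)) su us => u su us; split.
- exists (fun x => star u * x * u) => x.
    by rewrite !mulrA su mul1r -mulrA su mulr1.
  by rewrite !mulrA us mul1r -mulrA us mulr1.
- by move=> a x y; rewrite mulrDr mulrDl -scalerAr -scalerAl.
- by move=> x y; rewrite -!mulrA (mulrA (star u)) su mul1r.
- by move=> x; rewrite !starM starK mulrA.
Qed.

Definition conjugation : cstar_action (subgroup G) A :=
  CStarAction conj_act1 conj_actM conj_act_aut.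

(* B is closed in A, so density in B may be tested with the closure in A. *)
Definition spans_densely : Prop :=
  closure (span [set uval u | u in [set` G]]) = B.

End Conjugation.

(* Main.v *)
Require Import Defs.
From HB Require Import structures.
From mathcomp Require Import all_boot all_order all_algebra.
From mathcomp Require Import complex ring.
From mathcomp Require Import boolp classical_sets reals topology normedtype.

Set Implicit Arguments.
Unset Strict Implicit.
Unset Printing Implicit Defensive.

Import Order.TTheory GRing.Theory Num.Theory.
Import numFieldNormedType.Exports.

Local Open Scope classical_set_scope.
Local Open Scope ring_scope.

(* (1) => (2): a G-invariant closed left ideal I satisfies I u <= I for u in G,
   hence I B <= I by density.  So B lies in the idealizer
   D = {d | I d <= I and I d^* <= I}, in which I `&` I^* is a closed ideal;
   simplicity of D makes this ideal 0 or D, that is I = 0 or 1 \in I.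
   (2) => (3): take all of U(B).  For self-adjoint h and small t > 0 the Cayley
   transform w of th is a unitary and (w - 1) / (-2it) is close to h.
   (3) => (1): given a closed ideal J of D with B <= D <= A, the set of x in A for which
   |x c| can be made small, after any contraction in 1 + J, by a further
   contraction c in 1 + J is a G-invariant closed left ideal of A.  It contains
   J: since (1 + ish)^-1 is half of 1 plus a unitary, |(1 + ish)^-1| <= 1 and
   |h (1 + ish)^-1| <= 1/s for self-adjoint h, which needs no functional
   calculus; apply this to h = x^* x.  If it is all of A, then 1 + J contains an
   element of norm at most 1/2, whence 1 \in J by the Neumann series. *)

(** * Archimedean bounds for real elements of [R[i]] *)

Lemma complex_archi (R : realType) (x : R[i]) :
  x \is Num.real -> exists n, x < n%:R.
Proof.
move=> xr; exists (Num.bound `|complex.Re x|).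
rewrite -(RRe_real xr) -(rmorph_nat (real_complex R)) ltcR.
by rewrite (le_lt_trans (ler_norm _)) // archi_boundP.
Qed.

Lemma half_exp_lt (R : realType) (e : R[i]) :
  0 < e -> exists n, 2^-1 ^+ n < e.
Proof.
move=> e0; have [|n en] := @complex_archi R e^-1.
  by rewrite realV gtr0_real.
exists n; rewrite exprVn -(invrK e) ltf_pV2 ?posrE ?invr_gt0 ?exprn_gt0 //.
rewrite (lt_trans en) // -natrX ltr_nat; exact: ltn_expl.
Qed.

(** * Closed sets and the involution in terms of the norm *)

Section ClosedSubsets.
Context {R : realType} {A : cstarAlgType R}.
Implicit Types (S D I : set A) (x y : A).

Lemma closure_normP S x :
  closure S x <-> (forall e, 0 < e -> exists2 y, S y & `|x - y| < e).
Proof.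
split=> [Sx e e0|Sx V /nbhs_ballP[e /= e0 eV]].
  by have [y [Sy]] := Sx _ (nbhsx_ballx x _ e0); rewrite -ball_normE; exists y.
by have [y Sy xy] := Sx _ e0; exists y; split=> //; apply: eV; rewrite -ball_normE.
Qed.

Lemma closed_normP I : closed I <->
  (forall x, (forall e, 0 < e -> exists2 y, I y & `|x - y| < e) -> I x).
Proof.
by split=> Icl x; [move/closure_normP/Icl|move/closure_normP/Icl].
Qed.

Lemma closed_lipschitz_preimage (f : A -> A) (M : R[i]) I :
    0 < M -> (forall x y, `|f x - f y| <= M * `|x - y|) -> closed I ->
  closed (f @^-1` I).
Proof.
move=> M0 fM /closed_normP Icl; apply/closed_normP => x fIx /=.
apply: Icl => e e0; have [|y Iy xy] := fIx (e / M); first by rewrite divr_gt0.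
by exists (f y) => //; rewrite (le_lt_trans (fM x y)) // mulrC -ltr_pdivlMr.
Qed.

Lemma closed_mull_preimage x I : closed I -> closed [set y | I (x * y)].
Proof.
apply: (@closed_lipschitz_preimage _ (`|x| + 1)); first by rewrite ltr_wpDl.
move=> y z; rewrite -mulrBr (le_trans (cstar_normM _ _)) //.
by rewrite ler_wpM2r // lerDl.
Qed.

(** The C*-identity gives |x|^2 = |x^* x| <= |x^*| |x|, and |x| cancels when x is nonzero. *)
Lemma norm_star_le x : `|x| <= `|star x|.
Proof.
have [->|x0] := eqVneq x 0; first by rewrite normr0.
rewrite -(ler_pM2r (_ : 0 < `|x|)) ?normr_gt0 // -expr2 -cstar_normE.
exact: cstar_normM.
Qed.

Lemma norm_star x : `|star x| = `|x|.
Proof.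
by apply/le_anti; rewrite norm_star_le andbT -{2}(starK x) norm_star_le.
Qed.

Lemma star0 : star 0 = 0 :> A.
Proof. by apply/eqP; rewrite -normr_eq0 norm_star normr0. Qed.

Lemma starN x : star (- x) = - star x.
Proof. by apply/eqP; rewrite -addr_eq0 -starD addNr star0. Qed.

Lemma starB x y : star (x - y) = star x - star y.
Proof. by rewrite starD starN. Qed.

Lemma closed_star_preimage I : closed I -> closed [set y | I (star y)].
Proof.
apply: (@closed_lipschitz_preimage _ 1) => // x y.
by rewrite mul1r -starB norm_star.
Qed.

Lemma normc1 : `|1 : A| = 1.
Proof.
apply: (@mulfI _ `|1 : A|); first by rewrite normr_eq0 oner_eq0.
by rewrite mulr1 -expr2 -cstar_normE star1 mulr1.
Qed.

Lemma norm_isometry x : star x * x = 1 -> `|x| = 1.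
Proof.
move=> xx; apply/eqP; rewrite -(@eqrXn2 _ 2) //.
by rewrite -cstar_normE xx normc1 expr1n.
Qed.

Lemma submodP D : submod_closed [in D] <->
  D 0 /\ forall (a : R[i]) x y, D x -> D y -> D (a *: x + y).
Proof.
split=> -[D0 DD]; split; try exact/set_mem; try exact/mem_set.
  by move=> a x y Dx Dy; apply/set_mem/DD; apply/mem_set.
by move=> a x y /set_mem Dx /set_mem Dy; apply/mem_set/DD.
Qed.

Lemma norm_le_mul_eps (M : R[i]) x :
  0 < M -> (forall e, 0 < e -> `|x| <= M * e) -> x = 0.
Proof.
move=> M0 xM; apply/eqP; rewrite -normr_eq0; apply/contraT => x0.
have {}x0 : 0 < `|x| by rewrite lt_def x0 normr_ge0.
(* Taking e = |x| / (2M) gives |x| <= |x| / 2. *)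
have /xM : 0 < `|x| / (M * 2) by rewrite divr_gt0 ?mulr_gt0.
rewrite invfM mulrCA mulVKf ?gt_eqF // => /le_lt_trans; move/(_ `|x|).
by rewrite ltr_pdivrMr // ltr_pMr // ltr1n ltxx => /(_ isT).
Qed.

Section Submodule.
Variables (D : set A) (Dsub : submod_closed [in D]).

Lemma submod0 : D 0. Proof. by case/submodP: Dsub. Qed.
Lemma submodZ (a : R[i]) x : D x -> D (a *: x).
Proof.
by move=> Dx; rewrite -[_ *: _]addr0; have /submodP[D0] := Dsub; apply.
Qed.
Lemma submodD x y : D x -> D y -> D (x + y).
Proof. by move=> Dx Dy; rewrite -[x]scale1r; have /submodP[_] := Dsub; apply. Qed.
Lemma submodN x : D x -> D (- x).
Proof. by rewrite -scaleN1r; exact: submodZ. Qed.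
Lemma submodB x y : D x -> D y -> D (x - y).
Proof. by move=> Dx Dy; apply: submodD => //; exact: submodN. Qed.

End Submodule.

(** * Neumann series and perturbation of inverses *)

Lemma neumann D y : cstar_subalgebra D -> D 1 -> D y -> `|y| <= 2^-1 ->
  exists z, [/\ D z, (1 - y) * z = 1 & z * (1 - y) = 1].
Proof.
move=> [Dsub DM _ Dcl _] D1 Dy y2.
pose s n := \sum_(k < n) y ^+ k.
have Dyn n : D (y ^+ n) by elim: n => // n IH; rewrite exprS; exact: DM.
have Ds n : D (s n).
  elim: n => [|n IH]; rewrite /s ?big_ord0 ?big_ord_recr /=; first exact: submod0.
  exact: submodD.
have yn n : `|y ^+ n| <= 2^-1 ^+ n.
  elim: n => [|n IH]; first by rewrite !expr0 normc1.
  by rewrite !exprS (le_trans (cstar_normM _ _)) // ler_pM.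
(* The right-hand side is the exact sum of 2^-k over n <= k < n + m, so the induction step is an
   equality between bounds. *)
have snm n m : `|s (n + m)%N - s n| <= 2 * 2^-1 ^+ n * (1 - 2^-1 ^+ m).
  elim: m => [|m IH]; first by rewrite addn0 !subrr normr0 mulr0.
  rewrite addnS {1}/s big_ord_recr /= -/(s _) addrAC.
  rewrite (le_trans (ler_normD _ _)) // (le_trans (lerD IH (yn _))) //.
  rewrite exprD exprS -subr_ge0; set a := _ ^+ n; set b := _ ^+ m.
  suff -> : 2 * a * (1 - 2^-1 * b) - (2 * a * (1 - b) + a * b) = 0 :> R[i] by [].
  by field.
have scvg : cvg (s @ \oo).
  apply/cauchy_cvgP/cauchy_exP => e e0; have [|n en] := @half_exp_lt _ (e / 2).
    by rewrite divr_gt0.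
  exists (s n), n => // m /= nm; rewrite -ball_normE /= distrC -(subnKC nm).
  rewrite (le_lt_trans (snm _ _)) //.
  rewrite (@le_lt_trans _ _ (2 * 2^-1 ^+ n)) //; last first.
    by rewrite mulrC -ltr_pdivlMr.
  rewrite ler_piMr ?mulr_ge0 ?exprn_ge0 ?invr_ge0 //.
  by rewrite gerBl exprn_ge0 ?invr_ge0.
have sE n : (1 - y) * s n = 1 - y ^+ n.
  by rewrite -[RHS]opprB subrX1 -mulNr opprB.
have sC n : s n * (1 - y) = (1 - y) * s n.
  apply/esym/commr_sum => k _; apply/commr_sym/commrB; first exact: commr1.
  exact/commr_sym/commrX.
set z := lim (s @ \oo) in scvg *.
(* One index n controls both error terms in (1 - y) z - 1 = (1 - y) (z - s_n) - y^n. *)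
have s_near e : 0 < e -> exists n, `|z - s n| <= e /\ `|y ^+ n| <= e.
  move=> e0; have /cvgrPdist_lt/(_ _ e0)[N _ zN] := scvg.
  have [n en] := half_exp_lt e0; exists (maxn N n); split.
    by apply/ltW/zN => /=; exact: leq_maxl.
  rewrite (le_trans (yn _)) // (le_trans _ (ltW en)) //.
  by rewrite ler_wiXn2l ?leq_maxr ?invr_ge0 // invf_le1 // ler1n.
exists z; split.
- by apply: (closed_cvg (F := \oo) D) scvg => //; exists 0%N.
- apply/subr0_eq; apply: (@norm_le_mul_eps (`|1 - y| + 1)) => [|e /s_near[n [zn yne]]].
    by rewrite ltr_wpDl.
  have -> : (1 - y) * z - 1 = (1 - y) * (z - s n) - y ^+ n.
    by rewrite mulrBr sE opprB addrA addrAC addrK.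
  rewrite [leRHS]mulrDl mul1r (le_trans (ler_normB _ _)) // lerD //.
  by rewrite (le_trans (cstar_normM _ _)) // ler_wpM2l.
- apply/subr0_eq; apply: (@norm_le_mul_eps (`|1 - y| + 1)) => [|e /s_near[n [zn yne]]].
    by rewrite ltr_wpDl.
  have -> : z * (1 - y) - 1 = (z - s n) * (1 - y) - y ^+ n.
    by rewrite mulrBl sC sE opprB addrA addrAC addrK.
  rewrite [leRHS]mulrDl mul1r (le_trans (ler_normB _ _)) // lerD // mulrC.
  by rewrite (le_trans (cstar_normM _ _)) // ler_wpM2r.
Qed.

Definition inverse_in D x z := [/\ D z, x * z = 1 & z * x = 1].

(** Factor x + y = (1 + y z) x. Since |y z| <= 1/2, the first factor has a Neumann inverse v, and z
    v inverts the product. *)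
Lemma inverse_in_perturb D x y z : cstar_subalgebra D -> D 1 -> D y ->
    inverse_in D x z -> `|z| <= 1 -> `|y| <= 2^-1 ->
  exists z', inverse_in D (x + y) z'.
Proof.
move=> Dalg D1 Dy [Dz xz zx] z1 y2; have DM := cstar_subM Dalg.
have [||v [Dv vl vr]] := @neumann D (- (y * z)) Dalg D1.
- exact: submodN (cstar_sub_submod Dalg) _ (DM _ _ Dy Dz).
- rewrite normrN (le_trans (cstar_normM _ _)) // -[leRHS]mulr1.
  by rewrite ler_pM.
rewrite opprK in vl vr.
have xyE : x + y = (1 + y * z) * x by rewrite mulrDl mul1r -mulrA zx mulr1.
exists (z * v); split; first exact: DM.
  by rewrite mulrA mulrDl xz vl.
by rewrite xyE mulrA -(mulrA z) vr mulr1.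
Qed.

Lemma half_double y : y = 2^-1 *: (y + y).
Proof. by rewrite scalerDr -scalerDl -div1r -splitr scale1r. Qed.

(** * Resolvents of self-adjoint elements *)

Section Resolvent.
Variables (k x z : A).
Hypotheses (ks : star k = k) (xE : x = 1 + 'i *: k).
Hypotheses (rz : x * z = 1) (zr : z * x = 1).

Let xs : star x = 1 + 1 - x.
Proof.
rewrite xE starD star1 starZ ks conjCi scaleNr.
by rewrite opprD addrA addrK.
Qed.

(* [2z - 1] is the Cayley transform [(1 - ik)(1 + ik)^-1]. *)
Lemma cayley_unitary (w := z + z - 1) : star w * w = 1 /\ w * star w = 1.
Proof.
have xxC : x * star x = star x * x.
  by rewrite xs mulrBr mulrBl mulrDr mulrDl mulr1 mul1r.
have xsz : star x * star z = 1 by rewrite -starM zr star1.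
have zsx : star z * star x = 1 by rewrite -starM rz star1.
(* Since x^* = 2 - x and z x = 1, w is z x^*; unitarity then follows because x and x^* commute. *)
have wE : w = z * star x by rewrite xs mulrBr zr mulrDr mulr1.
have swE : star w = x * star z by rewrite wE starM starK.
have xzC : x * star z = star z * x.
  by rewrite -[LHS]mul1r -zsx -mulrA (mulrA (star x)) -xxC -mulrA xsz mulr1.
rewrite swE wE; split.
  by rewrite xzC mulrA -(mulrA (star z)) rz mulr1 zsx.
by rewrite mulrA -(mulrA z) -xxC mulrA zr mul1r xsz.
Qed.

(** Used to see that 1 - z lies in every ideal containing k, and to recover k z from the Cayley
    transform. *)
Lemma resolvent_compl : 'i *: (k * z) = 1 - z.
Proof. by rewrite -[X in X - _]rz xE mulrDl mul1r addrC addKr scalerAl. Qed.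

Lemma norm_resolvent : `|z| <= 1.
Proof.
have [/norm_isometry w1 _] := cayley_unitary.
rewrite [z]half_double -[z + z](subrK 1) normrZ gtr0_norm ?invr_gt0 //.
rewrite mulrC ler_pdivrMr // mul1r.
by rewrite (le_trans (ler_normD _ _)) // w1 normc1.
Qed.

(** |k z| = |1 - z|, and 1 - z is half of 1 - w for the unitary w = 2z - 1. *)
Lemma norm_mul_resolvent : `|k * z| <= 1.
Proof.
have [/norm_isometry w1 _] := cayley_unitary.
have -> : `|k * z| = `|1 - z| by rewrite -resolvent_compl normrZ normCi mul1r.
rewrite [1 - z]half_double.
have -> : 1 - z + (1 - z) = 1 - (z + z - 1).
  by rewrite addrACA opprB [RHS]addrA opprD.
rewrite normrZ gtr0_norm ?invr_gt0 // mulrC ler_pdivrMr // mul1r.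
by rewrite (le_trans (ler_normB _ _)) // w1 normc1.
Qed.

End Resolvent.

(** Write k = n k' with |k'| <= 1/2 and pass from 1 + imk' to 1 + i(m + 1)k'. The resolvent at each
    stage has norm at most 1, so a perturbation of norm at most 1/2 keeps invertibility, whatever
    the size of k. *)
Lemma resolvent_exists D k : cstar_subalgebra D -> D 1 -> D k -> star k = k ->
  exists z, inverse_in D (1 + 'i *: k) z.
Proof.
move=> Dalg D1 Dk ks; have Dsub := cstar_sub_submod Dalg.
have [|n kn] := @complex_archi R (2 * `|k|).
  by rewrite ger0_real ?mulr_ge0.
have n0 : n%:R != 0 :> R[i].
  by rewrite gt_eqF // (le_lt_trans _ kn) ?mulr_ge0.
pose k' := n%:R^-1 *: k.
have Dk' : D k' by exact: submodZ.
have k's : star k' = k' by rewrite starZ ks conj_Creal // realV realn.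
have kE : k = n%:R *: k' by rewrite scalerA divff ?scale1r.
have k'2 : `|k'| <= 2^-1.
  rewrite normrZ normfV normr_nat mulrC ler_pdivrMr ?lt0r ?n0 ?ler0n //.
  by rewrite mulrC ler_pdivlMr // mulrC ltW.
rewrite kE; elim: (n) => [|m [z zP]].
  by exists 1; rewrite scale0r scaler0 addr0; split; rewrite ?mulr1.
have [Dz xz zx] := zP.
rewrite -addn1 natrD scalerDl scale1r scalerDr addrA.
apply: (inverse_in_perturb Dalg D1 _ zP); first exact: submodZ.
  apply: (norm_resolvent _ (erefl _)) xz zx.
  by rewrite starZ k's conj_Creal // realn.
by rewrite normrZ normCi mul1r.
Qed.

(** * Contractions in 1 + J for a closed ideal J *)

Lemma ideal_one D J c : cstar_subalgebra D -> D 1 -> closed_ideal D J ->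
  J (1 - c) -> `|c| <= 2^-1 -> J = D.
Proof.
move=> Dalg D1 [JD Jsub Jl Jr _] Jc c2; have Dsub := cstar_sub_submod Dalg.
have Dc : D c by rewrite -[c](subKr 1); apply: submodB => //; exact: JD.
have [z [Dz cz _]] := neumann Dalg D1 Dc c2.
have J1 : J 1 by rewrite -cz; exact: Jr.
by apply/seteqP; split=> // x Dx; rewrite -[x]mulr1; exact: Jl.
Qed.

(** With h = x^* x take c = (1 + i e^-2 h)^-1. Then |x c|^2 = |c^* h c| <= |h c| <= e^2. *)
Lemma ideal_contraction D J x e : cstar_subalgebra D -> D 1 ->
    closed_ideal D J -> J x -> 0 < e ->
  exists c, [/\ J (1 - c), `|c| <= 1 & `|x * c| <= e].
Proof.
move=> Dalg D1 [JD Jsub Jl Jr _] Jx e0; have Dx := JD _ Jx.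
have sx := cstar_sub_star Dalg Dx; pose h := star x * x.
have Jh : J h by exact: Jl.
have s0 : 0 < e ^- 2 by rewrite invr_gt0 exprn_gt0.
pose k := e ^- 2 *: h; have Jk : J k by exact: submodZ.
have ks : star k = k.
  by rewrite starZ starM starK conj_Creal // gtr0_real.
have [z [Dz rz zr]] := resolvent_exists Dalg D1 (JD _ Jk) ks.
have z1 := norm_resolvent ks (erefl _) rz zr.
exists z; split=> //.
  rewrite -(resolvent_compl (erefl _) rz); apply: submodZ => //; exact: Jr.
have hz : `|h * z| <= e ^+ 2.
  have := norm_mul_resolvent ks (erefl _) rz zr.
  by rewrite -scalerAl normrZ gtr0_norm // mulrC ler_pdivrMr ?exprn_gt0 // mul1r.
rewrite -(@ler_pXn2r _ 2) ?nnegrE ?normr_ge0 ?(ltW e0) // -cstar_normE starM.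
rewrite -mulrA (mulrA (star x)) (le_trans (cstar_normM _ _)) //.
by rewrite -[leRHS]mul1r ler_pM // norm_star.
Qed.

(* A closed left ideal of the whole algebra that contains J, and contains 1
   only if some contraction in 1 + J has norm at most 1/2. *)
Definition contracted (J : set A) : set A :=
  [set x | forall c e, J (1 - c) -> `|c| <= 1 -> 0 < e ->
     exists c', [/\ J (1 - c'), `|c'| <= 1 & `|x * c * c'| <= e]].

Lemma contraction_mul D J c c' : cstar_subalgebra D -> D 1 ->
    closed_ideal D J -> J (1 - c) -> J (1 - c') -> J (1 - c * c').
Proof.
move=> Dalg D1 [JD Jsub Jl Jr _] Jc Jc'.
have Dc : D c.
  rewrite -[c](subKr 1); apply: submodB (cstar_sub_submod Dalg) _ _ D1 _.
  exact: JD.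
have -> : 1 - c * c' = 1 - c + c * (1 - c').
  by rewrite mulrBr mulr1 addrA subrK.
by apply: submodD => //; exact: Jl.
Qed.

Lemma norm_mul_le1 x y : `|x| <= 1 -> `|y| <= 1 -> `|x * y| <= 1.
Proof.
by move=> x1 y1; rewrite (le_trans (cstar_normM _ _)) // mulr_ile1.
Qed.

Lemma norm_mulr_le x y : `|y| <= 1 -> `|x * y| <= `|x|.
Proof.
by move=> y1; rewrite (le_trans (cstar_normM _ _)) // ler_piMr.
Qed.

(** Asking for smallness after every earlier contraction c is what handles sums: the contractions
    for the two summands can be applied one after the other. *)
Lemma contracted_left_ideal D J : cstar_subalgebra D -> D 1 ->
  closed_ideal D J -> closed_left_ideal (contracted J).
Proof.
move=> Dalg D1 Jid; have Jsub := ideal_submod Jid; split.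
- apply/submodP; split=> [c e Jc c1 e0|a x y Lx Ly c e Jc c1 e0].
    exists 1; split; rewrite ?subrr ?normc1 //; first exact: submod0.
    by rewrite !mul0r normr0 ltW.
  (* Adding 1 to |a| keeps the divisor positive when a = 0. *)
  have a1 : 0 < `|a| + 1 by rewrite ltr_wpDl.
  have [|||c1' [Jc' c1'1 xc]] := Lx c (e / 2 / (`|a| + 1)) => //.
    by rewrite !divr_gt0.
  have Jcc := contraction_mul Dalg D1 Jid Jc Jc'.
  (* The contraction for y is chosen after c c1'; multiplying by it preserves the bound already
     obtained for x. *)
  have [||c2 [Jc2 c21 yc]] := Ly (c * c1') (e / 2) Jcc.
  + exact: norm_mul_le1.
  + by rewrite divr_gt0.
  exists (c1' * c2); split.
  + exact: contraction_mul Dalg D1 Jid Jc' Jc2.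
  + exact: norm_mul_le1.
  rewrite !mulrA in yc *.
  rewrite !mulrDl (le_trans (ler_normD _ _)) // [leRHS]splitr lerD //.
  rewrite (le_trans (norm_mulr_le _ c21)) // -!scalerAl normrZ.
  rewrite (@le_trans _ _ ((`|a| + 1) * `|x * c * c1'|)) //.
    by rewrite ler_wpM2r // lerDl.
  by rewrite mulrC -ler_pdivlMr.
- move=> a x Lx c e Jc c1 e0; have a1 : 0 < `|a| + 1 by rewrite ltr_wpDl.
  have [|c' [Jc' c'1 xc]] := Lx c (e / (`|a| + 1)) Jc c1; first by rewrite divr_gt0.
  exists c'; split=> //; rewrite -!mulrA mulrA in xc *.
  rewrite (le_trans (cstar_normM _ _)) //.
  rewrite (@le_trans _ _ ((`|a| + 1) * `|x * c * c'|)) //.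
    by rewrite ler_wpM2r // lerDl.
  by rewrite mulrC -ler_pdivlMr // -mulrA.
- apply/closed_normP => x xL c e Jc c1 e0.
  have [|y Ly xy] := xL (e / 2); first by rewrite divr_gt0.
  have [|c' [Jc' c'1 yc]] := Ly c (e / 2) Jc c1; first by rewrite divr_gt0.
  exists c'; split=> //.
  rewrite -(subrK y x) (mulrDl _ y) (mulrDl _ (y * c)) [leRHS]splitr.
  rewrite (le_trans (ler_normD _ _)) // lerD //.
  by rewrite !(le_trans (norm_mulr_le _ _)) // ltW.
Qed.

(** x c = x - x (1 - c) stays in J, so [ideal_contraction] applies to x c. *)
Lemma sub_contracted D J : cstar_subalgebra D -> D 1 -> closed_ideal D J ->
  J `<=` contracted J.
Proof.
move=> Dalg D1 Jid x Jx c e Jc c1 e0; apply: (ideal_contraction Dalg) => //.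
rewrite -[c](subKr 1) mulrBr mulr1; apply: submodB => //.
  exact: ideal_submod Jid.
by apply: (ideal_mulr Jid) => //; apply: (ideal_sub Jid).
Qed.

(** Conjugation by u preserves the contractions in 1 + J. With v = u^*, use (u x v) c (u c' v) = u
    (x (v c u) c') v. *)
Lemma contracted_conj D J (u x : A) : cstar_subalgebra D -> closed_ideal D J ->
    D u -> star u * u = 1 -> u * star u = 1 -> contracted J x ->
  contracted J (u * x * star u).
Proof.
move=> Dalg Jid Du su us Lx c e Jc c1 e0; have Dsu := cstar_sub_star Dalg Du.
have nu := norm_isometry su.
have nsu : `|star u| = 1 by rewrite norm_star.
have conjJ (v w y : A) : D v -> D w -> v * w = 1 -> J (1 - y) -> J (1 - v * y * w).
  move=> Dv Dw vw Jy.
  have -> : 1 - v * y * w = v * (1 - y) * w by rewrite mulrBr mulr1 mulrBl vw.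
  by apply: (ideal_mulr Jid) => //; exact: (ideal_mull Jid).
have conj1 (v w y : A) : `|v| = 1 -> `|w| = 1 -> `|y| <= 1 -> `|v * y * w| <= 1.
  by move=> v1 w1 y1; rewrite !norm_mul_le1 ?v1 ?w1.
have [||c' [Jc' c'1 xc]] := Lx (star u * c * u) e _ _ e0.
- exact: conjJ.
- exact: conj1.
exists (u * c' * star u); split; [exact: conjJ|exact: conj1|].
rewrite -!mulrA (le_trans (cstar_normM _ _)) // nu mul1r !mulrA.
rewrite !mulrA in xc.
by rewrite (le_trans (norm_mulr_le _ _)) ?nsu.
Qed.

(** * C*-irreducibility from strong minimality *)

Section Inclusion.
Variable B : unitalCStarSub A.

Lemma irreducible_of_strongly_minimal (G : groupClosed (unitary B)) :
  strongly_minimal (conjugation G) -> cstar_irreducible B.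
Proof.
move=> Gmin D Dalg BD J Jid.
have D1 : D 1 by exact/BD/ucs_one.
have JL := sub_contracted Dalg D1 Jid; have Jsub := ideal_submod Jid.
have [||L0|LT] := Gmin (contracted J).
- exact: contracted_left_ideal D1 Jid.
- move=> g _ [x Lx <-]; have [Bg su us] := unitaryP (sgval g).
  by apply: (contracted_conj Dalg Jid) => //; exact: BD.
- left; rewrite L0 in JL.
  by apply/seteqP; split=> // x ->; exact: submod0.
- right; have : contracted J 1 by rewrite LT.
  (* The choice c = 1, e = 1/2 yields an element of 1 + J of norm at most 1/2. *)
  case/(_ 1 2^-1); rewrite ?subrr ?normc1 ?invr_gt0 //; first exact: submod0.
  by move=> c [Jc _]; rewrite !mul1r; exact: ideal_one.
Qed.

(** * The idealizer of a left ideal, and strong minimality from C*-irreducibility *)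

Definition idealizer (I : set A) : set A :=
  [set d | forall x, I x -> I (x * d) /\ I (x * star d)].

Lemma idealizer_subalgebra I :
  closed_left_ideal I -> cstar_subalgebra (idealizer I).
Proof.
move=> [Isub Il Icl]; split.
- apply/submodP; split=> [x Ix|a x y Dx Dy z Iz].
    by rewrite star0 mulr0; split; exact: submod0.
  have [zx zx'] := Dx _ Iz; have [zy zy'] := Dy _ Iz.
  rewrite starD starZ !mulrDr -!scalerAr.
  by split; apply: submodD => //; exact: submodZ.
- move=> x y Dx Dy z Iz; rewrite starM !mulrA; split.
    by apply Dy; apply Dx.
  by apply Dx; apply Dy.
- by move=> x Dx z /Dx[]; rewrite starK.
- have -> : idealizer I = \bigcap_(x in I)
      ([set d | I (x * d)] `&` [set d | I (x * star d)]).
    by apply/seteqP; split=> d Dd x /Dd.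
  apply: closed_bigI => x Ix; apply: closedI; first exact: closed_mull_preimage.
  by apply: (@closed_star_preimage [set d | I (x * d)]); exact: closed_mull_preimage.
- move=> D0; have: idealizer I 1 by move=> x Ix; rewrite star1 mulr1.
  by rewrite D0 => /eqP; rewrite oner_eq0.
Qed.

(** For d x, the adjoint x^* d^* lies in I because d idealizes I; for x d, it is x d itself that
    needs this, its adjoint being d^* x^*. *)
Lemma idealizer_ideal I : closed_left_ideal I ->
  closed_ideal (idealizer I) (I `&` [set x | I (star x)]).
Proof.
move=> [Isub Il Icl]; split.
- by move=> x [Ix Isx] y Iy; split; exact: Il.
- apply/submodP; split=> [|a x y [Ix Isx] [Iy Isy]].
    by split; rewrite /= ?star0; exact: submod0.
  by split; rewrite /= ?starD ?starZ; apply: submodD => //; exact: submodZ.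
- move=> d x Dd [Ix Isx]; split; first exact: Il.
  by rewrite /= starM; apply Dd.
- move=> d x Dd [Ix Isx]; split; first by apply Dd.
  by rewrite /= starM; exact: Il.
- by apply: closedI => //; exact: closed_star_preimage.
Qed.

(** For u in G, x u = u (u^* x u) lies in I by invariance under u^-1; linearity and closedness of I
    extend this to b in B. *)
Lemma invariant_left_ideal_mulr (G : groupClosed (unitary B)) I :
    spans_densely G -> closed_left_ideal I ->
    (forall g, conjugation G g @` I `<=` I) ->
  forall x b, I x -> (B : set A) b -> I (x * b).
Proof.
move=> Gd [Isub Il Icl] GI x b Ix; rewrite -{1}Gd => Bb.
have /closed_normP := @closed_mull_preimage x _ Icl; apply.
move=> e /(proj1 (closure_normP _ _) Bb)[y [n [c [s [Ss yE]]]] be].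
exists y => //=; rewrite yE mulr_sumr.
apply: (big_ind I) => [|v w|i _]; [exact: submod0|exact: submodD|].
rewrite -scalerAr; apply: submodZ => //.
have [u uG <-] := Ss i; have [_ su us] := unitaryP u.
have uVG : (u^-1)%g \in G by rewrite gpredV.
have := GI (Subgroup uVG) _ (ex_intro2 _ _ x Ix erefl).
rewrite /= /conj_act /= starK => /(Il (uval u)).
by rewrite !mulrA us mul1r.
Qed.

Lemma strongly_minimal_of_irreducible (G : groupClosed (unitary B)) :
  cstar_irreducible B -> spans_densely G -> strongly_minimal (conjugation G).
Proof.
move=> Birr Gd I Ilid GI; have [Isub Il _] := Ilid.
have BD : B `<=` idealizer I.
  move=> b Bb x Ix; split; apply: (invariant_left_ideal_mulr Gd) => //.
  exact: cstar_sub_star (ucs_subalgebra B) _ Bb.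
have [N0|ND] := Birr _ (idealizer_subalgebra Ilid) BD _ (idealizer_ideal Ilid).
- left; apply/seteqP; split=> x; last by move=> ->; exact: submod0.
  (* For x in I, x^* x is self-adjoint and in I, hence zero, and |x|^2 = |x^* x| = 0. *)
  move=> Ix; have : (I `&` [set x | I (star x)]) (star x * x).
    by split; rewrite /= ?starM ?starK; exact: Il.
  rewrite N0 => /= xx; apply/eqP; rewrite -normr_eq0 -sqrf_eq0 -cstar_normE.
  by rewrite xx normr0.
- right; have : idealizer I 1 by move=> x Ix; rewrite star1 mulr1.
  rewrite -ND => -[I1 _]; apply/seteqP; split=> // x _.
  by rewrite -[x]mulr1; exact: Il.
Qed.

(** * Density of the span of the unitaries *)

Lemma selfadjoint_near_unitary h e : (B : set A) h -> star h = h -> 0 < e ->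
  exists (c : R[i]) (u : unitary B), `|h - (c *: uval u - c *: 1)| <= e.
Proof.
move=> Bh hs e0; have Balg := ucs_subalgebra B; have Bsub := cstar_sub_submod Balg.
have B1 := ucs_one B.
have M0 : 0 < `|h| ^+ 2 + 1 by rewrite ltr_wpDl ?exprn_ge0.
(* The error will be h - h z = it h^2 z, of norm at most t |h|^2, hence at most e; the added 1
   covers h = 0. *)
pose t := e / (`|h| ^+ 2 + 1); have t0 : 0 < t by rewrite divr_gt0.
have ks : star (t *: h) = t *: h by rewrite starZ hs conj_Creal // gtr0_real.
have [z [Bz rz zr]] := resolvent_exists Balg B1 (submodZ Bsub t Bh) ks.
have [wl wr] := cayley_unitary ks (erefl _) rz zr.
have uw : unitary_in B (z + z - 1).
  apply/and3P; split; rewrite ?wl ?wr //; apply/mem_set.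
  by apply: submodB => //; exact: submodD.
have it0 : 'i * t != 0 by rewrite mulf_neq0 ?neq0Ci ?gt_eqF.
(* Since w - 1 = -2 (1 - z) = -2it h z, this scalar turns w - 1 into h z. *)
exists (- ('i * t)^-1 * 2^-1), (Unitary uw) => /=.
have zE : 1 - z = ('i * t) *: (h * z).
  by rewrite -(resolvent_compl (erefl _) rz) -scalerAl scalerA.
have -> : (- ('i * t)^-1 * 2^-1) *: (z + z - 1) - (- ('i * t)^-1 * 2^-1) *: 1
    = h * z.
  rewrite -scalerBr mulNr scaleNr -scalerN -scalerA.
  have -> : - (z + z - 1 - 1) = (1 - z) + (1 - z).
    by rewrite [RHS]addrACA !opprB [LHS]addrA opprD.
  by rewrite -half_double zE scalerA mulVf ?scale1r.
rewrite -{1}[h]mulr1 -mulrBr zE -scalerAr normrZ normrM normCi mul1r gtr0_norm //.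
have z1 := norm_resolvent ks (erefl _) rz zr.
rewrite (@le_trans _ _ (t * `|h| ^+ 2)) //.
  rewrite ler_wpM2l ?(ltW t0) // (le_trans (cstar_normM _ _)) // expr2.
  by rewrite ler_wpM2l // norm_mulr_le.
by rewrite mulrAC ler_pdivrMr // ler_wpM2l ?lerDl ?(ltW e0).
Qed.

(** Split b = p + iq with p and q self-adjoint and approximate each within e/2. Three unitaries
    suffice: one for each part, and 1, whose coefficient collects the scalar terms of both
    approximations. *)
Lemma near_unitary_span b e : (B : set A) b -> 0 < e ->
  exists2 y, Defs.span [set uval u | u in [set: unitary B]] y & `|b - y| <= e.
Proof.
move=> Bb e0; have Balg := ucs_subalgebra B; have Bsub := cstar_sub_submod Balg.
have Bsb := cstar_sub_star Balg Bb; have e2 : 0 < e / 2 by rewrite divr_gt0.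
have c2 : Num.conj (2^-1 : R[i]) = 2^-1 by rewrite conj_Creal // realV realn.
pose p := 2^-1 *: (b + star b); pose q := ('i * 2^-1) *: (star b - b).
have ps : star p = p by rewrite starZ c2 starD starK addrC.
have qs : star q = q.
  by rewrite starZ rmorphM /= conjCi c2 starB starK mulNr scaleNr -scalerN opprB.
have [|c [u pu]] := @selfadjoint_near_unitary p (e / 2) _ ps e2.
  by apply: submodZ => //; exact: submodD.
have [|d [v qv]] := @selfadjoint_near_unitary q (e / 2) _ qs e2.
  by apply: submodZ => //; exact: submodB.
have bE : b = p + 'i *: q.
  rewrite /p /q scalerA mulrA -expr2 sqrCi mulN1r scaleNr -scalerN opprB.
  by rewrite -scalerDr addrACA subrr addr0 -half_double.
pose one : unitary B := 1%g.
exists (c *: uval u + ('i * d) *: uval v + (- c - 'i * d) *: uval one).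
  exists 3, (fun i : 'I_3 => [:: c; 'i * d; - c - 'i * d]`_i).
  exists (fun i : 'I_3 => uval (nth one [:: u; v; one] i)); split.
    by move=> i; exists (nth one [:: u; v; one] i).
  by rewrite !big_ord_recl big_ord0 /= addr0 addrA.
have -> : b - (c *: uval u + ('i * d) *: uval v + (- c - 'i * d) *: uval one) =
    (p - (c *: uval u - c *: 1)) + 'i *: (q - (d *: uval v - d *: 1)).
  rewrite {1}bE !scalerBr !scalerA scalerDl !scaleNr !opprB !opprD !opprK /=.
  rewrite (addrACA (- (c *: _))) (addrACA p).
  by rewrite (addrC (- (c *: _))) (addrC (- (_ *: uval v))).
by rewrite (le_trans (ler_normD _ _)) // normrZ normCi mul1r [leRHS]splitr lerD.
Qed.

Definition full_unitary : groupClosed (unitary B) :=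
  @GroupClosed.pack_ (unitary B) predT
    (isInvClosed.Build (unitary B) predT (fun _ _ => isT))
    (isMul1Closed.Build (unitary B) predT isT)
    (isMulClosed.Build (unitary B) predT (fun _ _ _ _ => isT)).

Lemma full_unitary_spans_densely : spans_densely full_unitary.
Proof.
have Balg := ucs_subalgebra B; have Bsub := cstar_sub_submod Balg.
apply/seteqP; split=> b.
  move/closure_normP => bS; have /closed_normP := cstar_sub_closed Balg; apply.
  move=> e /bS[y [n [c [s [Ss ->]]]] be]; eexists; last exact: be.
  apply: (big_ind (B : set A)) => [|v w|i _]; [exact: submod0|exact: submodD|].
  by apply: submodZ => //; have [u _ <-] := Ss i; have [] := unitaryP u.
move=> Bb; apply/closure_normP => e e0.
(* Halving e turns the non-strict estimate into the strict one required by the closure. *)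
have [|y [n [c [s [Ss yE]]]] be] := @near_unitary_span b (e / 2) Bb.
  by rewrite divr_gt0.
exists y; last by rewrite (le_lt_trans be) // ltr_pdivrMr // ltr_pMr // ltr1n.
by exists n, c, s; split=> // i; have [u _ <-] := Ss i; exists u.
Qed.

End Inclusion.
End ClosedSubsets.

Theorem theorem2 (R : realType) (A : cstarAlgType R) (B : unitalCStarSub A) :
  [<-> cstar_irreducible B;
       forall G : groupClosed (unitary B),
         spans_densely G -> strongly_minimal (conjugation G);
       exists G : groupClosed (unitary B),
         spans_densely G /\ strongly_minimal (conjugation G)].
Proof.
tfae.
- by move=> Birr G; exact: strongly_minimal_of_irreducible.
- move=> Gmin; exists (full_unitary B).
  by split; [|apply: Gmin]; exact: full_unitary_spans_densely.
- by move=> [G [_ Gmin]]; exact: irreducible_of_strongly_minimal Gmin.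
Qed.
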